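(* Let $g=dy_1^2+dy_2^2+(y_1\,dy_2+dy_3)^2$ be the metric of the geometry $\mathrm{Nil}$ on $\mathbb R^3$ and let $$E=-y_1\frac{\partial}{\partial y_1}-y_2\frac{\partial}{\partial y_2}-2y_3\frac{\partial}{\partial y_3}.$$ Then $-2\,\mathrm{Ricci}(g)=\mathcal L_Eg+2Ag$ with $A=\tfrac32$, so that $(\mathbb R^3,g)$ with $E$ is a Ricci soliton; and it is not of gradient type: the $1$-form $E^\flat=g(E,\cdot)$ is not closed, so $E$ is not the gradient of a function.
   Context: A Ricci soliton is a Riemannian manifold $(M,g)$ with a vector field $E$ and a constant $A$ such that $-2\,\mathrm{Ricci}(g)=\mathcal L_Eg+2Ag$. It is of gradient type if $E=\mathrm{grad}\,F$ for some function $F$. *)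

(* Defs.v *)
From HB Require Import structures.
From mathcomp Require Import all_boot all_order all_algebra.
From mathcomp Require Import all_classical all_reals all_analysis.

Set Implicit Arguments.
Unset Strict Implicit.
Unset Printing Implicit Defensive.

Import Order.TTheory GRing.Theory Num.Theory.
Import numFieldNormedType.Exports.

Local Open Scope ring_scope.

(* Tensor fields on R^n are given by their components in the standard
   coordinates:
   - a vector field E is x |-> \row_i E^i(x), standing for E^i d/dx_i;
   - a 1-form a is x |-> \row_i a_i(x), standing for a_i dx_i;
   - a symmetric 2-tensor is x |-> \matrix_(i, j) g_ij(x). *)

Section TensorCalculus.
Variables (R : realType) (n : nat).

Local Notation scalar_field := ('rV[R]_n -> R).
Local Notation vector_field := ('rV[R]_n -> 'rV[R]_n).
Local Notation one_form := ('rV[R]_n -> 'rV[R]_n).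
Local Notation two_tensor := ('rV[R]_n -> 'M[R]_n).

Definition partial (i : 'I_n) (f : scalar_field) : scalar_field :=
  fun x => 'D_(delta_mx 0 i) f x.

Fixpoint is_Ck (k : nat) (f : scalar_field) : Prop :=
  if k is k'.+1 then
    (forall x, differentiable f x) /\ (forall i, is_Ck k' (partial i f))
  else continuous f.

Definition smooth (f : scalar_field) : Prop := forall k, is_Ck k f.

Definition smooth_vector_field (E : vector_field) : Prop :=
  forall i, smooth (fun x => E x 0 i).

Definition riemannian_metric (g : two_tensor) : Prop :=
  [/\ forall i j, smooth (fun x => g x i j),
      forall x, (g x)^T = g x
    & forall x (v : 'rV[R]_n), v != 0 -> 0 < (v *m g x *m v^T) 0 0].

(* Gamma^k_ij of the Levi-Civita connection of g. *)
Definition christoffel (g : two_tensor) (k i j : 'I_n) : scalar_field :=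
  fun x => 2^-1 * \sum_l invmx (g x) k l *
    (partial i (fun y => g y j l) x + partial j (fun y => g y i l) x
     - partial l (fun y => g y i j) x).

(* The d/dx_l component of R(d/dx_i, d/dx_j) d/dx_k, with the convention
   R(X, Y) Z = D_X D_Y Z - D_Y D_X Z - D_[X, Y] Z. *)
Definition riemann (g : two_tensor) (l k i j : 'I_n) : scalar_field :=
  fun x => partial i (christoffel g l j k) x - partial j (christoffel g l i k) x
    + \sum_m (christoffel g l i m x * christoffel g m j k x
              - christoffel g l j m x * christoffel g m i k x).

(* Ricci(Y, Z) is the trace of X |-> R(X, Y) Z; with this sign round spheres
   have positive Ricci curvature. *)
Definition ricci (g : two_tensor) : two_tensor :=
  fun x => \matrix_(j, k) \sum_i riemann g i k i j x.

Definition lie_derivative (E : vector_field) (g : two_tensor) : two_tensor :=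
  fun x => \matrix_(i, j) \sum_k
    (E x 0 k * partial k (fun y => g y i j) x
     + g x k j * partial i (fun y => E y 0 k) x
     + g x i k * partial j (fun y => E y 0 k) x).

Definition ricci_soliton_eq (g : two_tensor) (E : vector_field) (A : R) : Prop :=
  forall x, - 2 *: ricci g x = lie_derivative E g x + (2 * A) *: g x.

Definition ricci_soliton (g : two_tensor) (E : vector_field) : Prop :=
  [/\ riemannian_metric g, smooth_vector_field E
    & exists A : R, ricci_soliton_eq g E A].

(* The 1-form g(E, -). *)
Definition flat (g : two_tensor) (E : vector_field) : one_form :=
  fun x => E x *m g x.

Definition differential (F : scalar_field) : one_form :=
  fun x => \row_i partial i F x.

(* The components g^ij d_j F of the vector field dual to dF. *)
Definition grad (g : two_tensor) (F : scalar_field) : vector_field :=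
  fun x => differential F x *m invmx (g x).

(* F is only required to be differentiable, the least regularity for which dF
   makes sense; when g and E are smooth, such an F is automatically smooth. *)
Definition gradient_type (g : two_tensor) (E : vector_field) : Prop :=
  exists F : scalar_field,
    (forall x, differentiable F x) /\ (forall x, E x = grad g F x).

(* (d a)_ij = d_i a_j - d_j a_i, i.e. d a (d/dx_i, d/dx_j). *)
Definition exterior_derivative (a : one_form) : two_tensor :=
  fun x => \matrix_(i, j)
    (partial i (fun y => a y 0 j) x - partial j (fun y => a y 0 i) x).

Definition closed_form (a : one_form) : Prop :=
  forall x, exterior_derivative a x = 0.

(* The symmetric 2-tensor a^2 = a (x) a of a covector a. *)
Definition form_sq (a : 'rV[R]_n) : 'M[R]_n := a^T *m a.

End TensorCalculus.

Section Nil.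
Variable R : realType.

(* In 'I_3 the numerals 0, 1, 2 denote the ordinals with these values; they
   index the coordinates y_1, y_2, y_3. *)
Definition y1 (y : 'rV[R]_3) : R := y 0 0.
Definition y2 (y : 'rV[R]_3) : R := y 0 1.
Definition y3 (y : 'rV[R]_3) : R := y 0 2.

(* Since both are written as row vectors, e1, e2, e3 serve as the coordinate
   1-forms dy_i as well as the coordinate vector fields d/dy_i. *)
Definition e1 : 'rV[R]_3 := delta_mx 0 0.
Definition e2 : 'rV[R]_3 := delta_mx 0 1.
Definition e3 : 'rV[R]_3 := delta_mx 0 2.

Definition nil_metric (y : 'rV[R]_3) : 'M[R]_3 :=
  form_sq e1 + form_sq e2 + form_sq (y1 y *: e2 + e3).

Definition nil_field (y : 'rV[R]_3) : 'rV[R]_3 :=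
  - y1 y *: e1 - y2 y *: e2 - (2 * y3 y) *: e3.

End Nil.

Arguments nil_metric {R} y.
Arguments nil_field {R} y.

(* Main.v *)
Require Import Defs.
From mathcomp Require Import all_boot all_order all_algebra.
From mathcomp Require Import all_classical all_reals all_analysis.
From mathcomp Require Import ring lra.
Import Order.TTheory GRing.Theory Num.Theory.
Import numFieldNormedType.Exports.
Local Open Scope ring_scope.

Set Implicit Arguments.
Unset Strict Implicit.
Unset Printing Implicit Defensive.

(** The coframe [dy1], [dy2], [y1 dy2 + dy3] is orthonormal for [g], and in it [Ricci] is diagonal
    with entries -1/2, -1/2, 1/2. The flow of [E] consists of the dilations of Nil, and [E] scales
    the coframe by the weights -1, -1, -2, so the Lie derivative of [g] has entries -2, -2, -4;
    adding [3 g] gives 1, 1, -1, which is [-2 Ricci]. The formal check works in coordinates. The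
    metric, its inverse and the Christoffel symbols are polynomials in [y1] alone, and each
    component of [E] is a polynomial in its own coordinate, so by [partial_horner_coord] all
    derivatives become formal ones and [nil_ricci_soliton_eq] is an identity of polynomials, entry
    by entry. If [E] were a gradient of [F], then [dF] would be the dual form of [E]
    ([gradient_flat]); [increment_along_line] integrates that form along two paths with common ends
    and finds different values. *)

Section PartialsAlongLines.
Variables (R : realType) (n : nat).
Implicit Types (p : {poly R}) (x a : 'rV[R]_n) (f F : 'rV[R]_n -> R).

(** * Partial derivatives and increments along coordinate lines *)

Lemma partial_line f x (i : 'I_n) p :
  (forall t, f (x + t *: delta_mx 0 i) = p.[t]) -> partial i f x = p^`().[0].
Proof.
(* The difference quotients of [f] at [x] in direction [i] and of [p] at 0 are the same function of
   [h], so their limits agree. *)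
move=> fp; rewrite derivE /partial /derive /derive1.
apply: (congr1 (fun q : R -> R => lim (q @ 0^')%classic)); apply/funext => h.
by rewrite addr0 -!fp scale0r addr0 (addrC x).
Qed.

(** The result is again a polynomial in the coordinate [j], even when it vanishes, so the rule can
    be iterated: smoothness follows by induction on the order. *)
Lemma partial_horner_coord p (i j : 'I_n) :
  partial i (fun x => p.[x 0 j]) = fun x => ((i == j)%:R *: p^`()).[x 0 j].
Proof.
apply/funext => x; have [<-|neq_ij] := eqVneq i j.
  rewrite (@partial_line _ _ _ (p \Po ('X + (x 0 i)%:P))) => [|t].
    by rewrite deriv_comp !(poly.derivE, hornerE, horner_comp).
  by rewrite !mxE !eqxx horner_comp !hornerE addrC.
rewrite (@partial_line _ _ _ (p.[x 0 j])%:P) => [|t].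
  by rewrite !(poly.derivE, hornerE).
by rewrite !mxE (eq_sym j) (negbTE neq_ij) andbF mulr0 addr0 hornerC.
Qed.

Lemma smooth_horner_coord p (j : 'I_n) : smooth (fun x => p.[x 0 j]).
Proof.
have dp q x : differentiable (fun x : 'rV[R]_n => q.[x 0 j]) x.
  apply: (@differentiable_comp _ _ _ _ (fun x : 'rV[R]_n => x 0 j) (horner q)).
    exact: differentiable_coord.
  exact/derivable1_diffP/derivable_horner.
move=> k; elim: k p => [|k IHk] p /=.
  by move=> x; apply/differentiable_continuous/dp.
by split=> [x|i]; [exact: dp | rewrite partial_horner_coord; exact: IHk].
Qed.

Lemma is_derive_line F a (i : 'I_n) (t : R) :
  differentiable F (a + t *: delta_mx 0 i) ->
  is_derive t 1 (fun s => F (a + s *: delta_mx 0 i))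
            (partial i F (a + t *: delta_mx 0 i)).
Proof.
set x := a + _ => dF.
have quotE : (fun h : R => h^-1 *: (F (h *: delta_mx 0 i + x) - F x))
    = fun h : R => h^-1 *: (F (a + (h *: (1 : R) + t) *: delta_mx 0 i) - F x).
  apply/funext => h; congr (_ *: (F _ - _)).
  by rewrite -[h *: (1 : R)]/(h * 1) mulr1 scalerDl addrCA.
apply: DeriveDef.
  by have := diff_derivable (v := delta_mx 0 i) dF; rewrite /derivable quotE.
by rewrite /partial /derive quotE.
Qed.

(** A fundamental theorem of calculus without integrals: [F] on the line minus [p] has zero
    derivative, hence is constant. *)
Lemma increment_along_line F a (i : 'I_n) p :
  (forall x, differentiable F x) ->
  (forall t, partial i F (a + t *: delta_mx 0 i) = p^`().[t]) ->
  F (a + delta_mx 0 i) - F a = p.[1] - p.[0].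
Proof.
move=> dF dFp.
pose f t := F (a + t *: delta_mx 0 i) - p.[t].
have /(_ 1 0) : forall s t, f s = f t.
  move=> s t; apply: is_derive_0_is_cst => {s}t.
  have := is_deriveB (is_derive_line (dF (a + t *: delta_mx 0 i)))
                     (is_derive_poly p t).
  by rewrite dFp subrr.
by rewrite /f scale1r scale0r addr0 => H; lra.
Qed.

Lemma gradient_flat (g : 'rV[R]_n -> 'M[R]_n) F :
  (forall x, g x \in unitmx) -> flat g (grad g F) = differential F.
Proof.
by move=> gU; apply/funext => x; rewrite /flat /grad mulmxKV.
Qed.

End PartialsAlongLines.

(** * Polynomial form of the Nil geometry and the soliton equation *)

Section Nil.
Variable R : realType.
Implicit Types (x y : 'rV[R]_3) (i j k : 'I_3).

Lemma ord3P i : [\/ i = 0, i = 1 | i = 2].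
Proof.
by case: i => [[|[|[|//]]] ?];
  [apply: Or31 | apply: Or32 | apply: Or33]; apply/val_inj.
Qed.

Definition nil_metric_poly i j : {poly R} :=
  nth 0 (nth [::] [:: [:: 1; 0; 0];
                      [:: 0; 1 + 'X^2; 'X];
                      [:: 0; 'X; 1]] i) j.

(** The inverse metric; it is polynomial because the metric has determinant 1. *)
Definition nil_cometric_poly i j : {poly R} :=
  nth 0 (nth [::] [:: [:: 1; 0; 0];
                      [:: 0; 1; - 'X];
                      [:: 0; - 'X; 1 + 'X^2]] i) j.

Definition nil_field_poly k : {poly R} := - (nth 0 [:: 1; 1; 2] k)%N%:R *: 'X.

(* The (i, j) entry of the k-th block is Gamma^k_ij. *)
Definition nil_christoffel_poly k i j : {poly R} :=
  let h : {poly R} := (2^-1)%:P in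
  nth 0 (nth [::] (nth [::]
    [:: [:: [:: 0; 0; 0];
            [:: 0; - 'X; - h];
            [:: 0; - h; 0]];
        [:: [:: 0; h * 'X; h];
            [:: h * 'X; 0; 0];
            [:: h; 0; 0]];
        [:: [:: 0; h * (1 - 'X^2); - (h * 'X)];
            [:: h * (1 - 'X^2); 0; 0];
            [:: - (h * 'X); 0; 0]]] k) i) j.

Lemma nil_metricE y i j : nil_metric y i j = (nil_metric_poly i j).[y 0 0].
Proof.
rewrite /nil_metric /form_sq /e1 /e2 /e3 /y1.
rewrite !mxE !big_ord_recl !big_ord0 !mxE.
by case: (ord3P i) => ->; case: (ord3P j) => ->;
  rewrite /nil_metric_poly /= !hornerE /=; ring.
Qed.

Lemma nil_fieldE y k : nil_field y 0 k = (nil_field_poly k).[y 0 k].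
Proof.
rewrite /nil_field /e1 /e2 /e3 /y1 /y2 /y3 !mxE.
by case: (ord3P k) => ->; rewrite /nil_field_poly /= !hornerE /=; ring.
Qed.

Lemma partial_nil_metric k i j :
  partial k (fun y => nil_metric y i j) =
  fun y => ((k == 0)%:R *: (nil_metric_poly i j)^`()).[y 0 0].
Proof.
by rewrite -partial_horner_coord; congr partial; apply/funext => y;
  rewrite nil_metricE.
Qed.

Lemma partial_nil_field i k :
  partial i (fun y => nil_field y 0 k) =
  fun y => ((i == k)%:R *: (nil_field_poly k)^`()).[y 0 k].
Proof.
by rewrite -partial_horner_coord; congr partial; apply/funext => y;
  rewrite nil_fieldE.
Qed.

Lemma nil_metricK y :
  nil_metric y *m (\matrix_(i, j) (nil_cometric_poly i j).[y 0 0]) = 1%:M.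
Proof.
apply/matrixP => i j; rewrite !mxE.
under eq_bigr => k _ do rewrite nil_metricE mxE.
rewrite !big_ord_recl big_ord0.
by case: (ord3P i) => ->; case: (ord3P j) => ->;
  rewrite /nil_metric_poly /nil_cometric_poly /= !hornerE /=; ring.
Qed.

Lemma nil_metric_unit y : nil_metric y \in unitmx.
Proof. by have [] := mulmx1_unit (nil_metricK y). Qed.

Lemma invmx_nil_metric y :
  invmx (nil_metric y) = \matrix_(i, j) (nil_cometric_poly i j).[y 0 0].
Proof.
by rewrite -[RHS](mulKmx (nil_metric_unit y)) nil_metricK mulmx1.
Qed.

Lemma nil_christoffelE k i j :
  christoffel (@nil_metric R) k i j =
  fun y => (nil_christoffel_poly k i j).[y 0 0].
Proof.
apply/funext => y; rewrite /christoffel invmx_nil_metric.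
under eq_bigr => l _ do rewrite !partial_nil_metric mxE.
rewrite !big_ord_recl big_ord0.
by case: (ord3P i) => ->; case: (ord3P j) => ->; case: (ord3P k) => ->;
  rewrite /nil_metric_poly /nil_cometric_poly /nil_christoffel_poly /=;
  rewrite !(poly.derivE, hornerE) /=; field.
Qed.

(** The Christoffel symbols depend on [y1] only, so a derivative survives just for the index 0. *)
Lemma nil_riemannE l k i j y :
  riemann (@nil_metric R) l k i j y =
  ((i == 0)%:R *: (nil_christoffel_poly l j k)^`()
   - (j == 0)%:R *: (nil_christoffel_poly l i k)^`()
   + \sum_m (nil_christoffel_poly l i m * nil_christoffel_poly m j k
             - nil_christoffel_poly l j m * nil_christoffel_poly m i k)).[y 0 0].
Proof.
rewrite /riemann !nil_christoffelE !partial_horner_coord.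
under eq_bigr => m _ do rewrite !nil_christoffelE.
rewrite !hornerE horner_sum; congr (_ - _ + _).
by apply: eq_bigr => m _; rewrite !hornerE.
Qed.

Lemma nil_ricci_soliton_eq :
  ricci_soliton_eq (@nil_metric R) nil_field (3 / 2).
Proof.
move=> y; apply/matrixP => i j.
(* Only the outer matrix layers are opened: the entries of [nil_metric] must stay folded for
   [nil_metricE] to match. *)
rewrite [LHS]mxE [X in _ * X]mxE [RHS]mxE [X in X + _]mxE [X in _ + X]mxE.
under eq_bigr => k _ do rewrite nil_riemannE.
under [in RHS]eq_bigr => k _ do
  rewrite partial_nil_metric !partial_nil_field nil_fieldE !nil_metricE.
rewrite nil_metricE !big_ord_recl !big_ord0.
by case: (ord3P i) => ->; case: (ord3P j) => ->;
  rewrite /nil_metric_poly /nil_christoffel_poly /nil_field_poly /=;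
  rewrite !(poly.derivE, hornerE) /=; field.
Qed.

(** * Positivity and smoothness *)

Lemma nil_metric_riemannian : riemannian_metric (@nil_metric R).
Proof.
split=> [i j | y | y v v0].
- rewrite (_ : (fun y => _) = fun y => (nil_metric_poly i j).[y 0 0]).
    exact: smooth_horner_coord.
  by apply/funext => y; rewrite nil_metricE.
- apply/matrixP => i j; rewrite mxE !nil_metricE.
  by case: (ord3P i) => ->; case: (ord3P j) => ->.
(* The squares of the three coframe values on [v]; if all vanish, the first two coordinates are 0,
   and then so is the third. *)
have -> : (v *m nil_metric y *m v^T) 0 0
    = v 0 0 ^+ 2 + v 0 1 ^+ 2 + (y 0 0 * v 0 1 + v 0 2) ^+ 2.
  rewrite mxE; under eq_bigr => k _.
    rewrite !mxE; under eq_bigr => l _ do rewrite nil_metricE; over.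
  rewrite !big_ord_recl !big_ord0 /nil_metric_poly /= !hornerE /=.
  have -> : lift ord0 ord0 = 1 :> 'I_3 by apply/val_inj.
  have -> : lift ord0 (lift ord0 ord0) = 2 :> 'I_3 by apply/val_inj.
  by ring.
rewrite lt0r !addr_ge0 ?sqr_ge0 // andbT; apply: contra v0.
rewrite !paddr_eq0 ?addr_ge0 ?sqr_ge0 // !sqrf_eq0.
case/andP=> /andP[/eqP v0 /eqP v1]; rewrite v1 mulr0 add0r => /eqP v2.
by apply/eqP/rowP => k; rewrite mxE; case: (ord3P k) => ->.
Qed.

Lemma nil_field_smooth : smooth_vector_field (@nil_field R).
Proof.
move=> k; rewrite (_ : (fun y => _) = fun y => (nil_field_poly k).[y 0 k]).
  exact: smooth_horner_coord.
by apply/funext => y; rewrite nil_fieldE.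
Qed.

(** * The dual form of the field: neither closed nor exact *)

Lemma nil_flatE y :
  (flat nil_metric nil_field y 0 1
     = - (y 0 1 * (1 + y 0 0 ^+ 2) + 2 * y 0 2 * y 0 0))
  * (flat nil_metric nil_field y 0 2 = - (y 0 0 * y 0 1 + 2 * y 0 2)).
Proof.
have flatE k : flat nil_metric nil_field y 0 k
    = \sum_l (nil_field_poly l).[y 0 l] * (nil_metric_poly l k).[y 0 0].
  by rewrite mxE; apply: eq_bigr => l _; rewrite nil_fieldE nil_metricE.
rewrite !flatE !big_ord_recl !big_ord0 /nil_metric_poly /nil_field_poly /=.
have -> : lift ord0 ord0 = 1 :> 'I_3 by apply/val_inj.
have -> : lift ord0 (lift ord0 ord0) = 2 :> 'I_3 by apply/val_inj.
by rewrite !hornerE /=; split; ring.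
Qed.

(* The (2, 3) component of d(E^flat) is y_1. *)
Lemma nil_flat_not_closed : ~ closed_form (flat (@nil_metric R) nil_field).
Proof.
(* At the point (1, 0, 0) this component is -1 - (-2) = 1. *)
move=> /(_ (@e1 R)) /matrixP /(_ 1 2); rewrite !mxE.
rewrite (@partial_line _ _ _ _ _ (- 'X)) => [|t].
  rewrite (@partial_line _ _ _ _ _ (- 2 *: 'X)) => [|t].
    by rewrite !(poly.derivE, hornerE) => H; lra.
  by rewrite nil_flatE !mxE !hornerE /=; ring.
by rewrite nil_flatE !mxE !hornerE /=; ring.
Qed.

(* F is not assumed C^2, so symmetry of its second derivatives is not available;
   integrating E^flat over two paths from (1, 0, 0) to (1, 1, 1) is. *)
Lemma nil_not_gradient : ~ gradient_type (@nil_metric R) nil_field.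
Proof.
case=> F [dF EF].
have dFE k y : partial k F y = flat nil_metric nil_field y 0 k.
  have -> : @nil_field R = grad nil_metric F by apply/funext.
  by rewrite (gradient_flat _ nil_metric_unit) mxE.
have incr a k p : (forall t, flat nil_metric nil_field (a + t *: delta_mx 0 k) 0 k
    = p^`().[t]) -> F (a + delta_mx 0 k) - F a = p.[1] - p.[0].
  by move=> aEp; apply: increment_along_line => // t; rewrite dFE.
(* Each polynomial is a primitive of the dual form on its edge. Going along [e2] and then [e3] gives
   -1 - 2 = -3, the other order -1 - 3 = -4; by Stokes the gap 1 is the integral of [y1] over the
   unit square in the plane [y1 = 1]. *)
have H2 : F (e1 R + e2 R) - F (e1 R) = (- 'X^2).[1] - (- 'X^2).[0].
  by apply: incr => t; rewrite nil_flatE !mxE !(poly.derivE, hornerE) /=; ring.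
have H23 : F (e1 R + e2 R + e3 R) - F (e1 R + e2 R)
    = (- 'X - 'X^2).[1] - (- 'X - 'X^2).[0].
  by apply: incr => t; rewrite nil_flatE !mxE !(poly.derivE, hornerE) /=; ring.
have H3 : F (e1 R + e3 R) - F (e1 R) = (- 'X^2).[1] - (- 'X^2).[0].
  by apply: incr => t; rewrite nil_flatE !mxE !(poly.derivE, hornerE) /=; ring.
have H32 : F (e1 R + e2 R + e3 R) - F (e1 R + e3 R)
    = (- 2 *: 'X - 'X^2).[1] - (- 2 *: 'X - 'X^2).[0].
  rewrite addrAC; apply: incr => t.
  by rewrite nil_flatE !mxE !(poly.derivE, hornerE) /=; ring.
by move: H2 H23 H3 H32; rewrite !hornerE => *; lra.
Qed.

End Nil.

Theorem mainTheorem3 (R : realType) :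
  [/\ forall y : 'rV[R]_3,
        - 2 *: ricci nil_metric y
        = lie_derivative nil_field nil_metric y
          + (2 * (3 / 2)) *: nil_metric y,
      ricci_soliton (@nil_metric R) nil_field,
      ~ closed_form (flat (@nil_metric R) nil_field)
    & ~ gradient_type (@nil_metric R) nil_field].
Proof.
split.
- exact: nil_ricci_soliton_eq.
- split; [exact: nil_metric_riemannian | exact: nil_field_smooth |].
  by exists (3 / 2); exact: nil_ricci_soliton_eq.
- exact: nil_flat_not_closed.
- exact: nil_not_gradient.
Qed.
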